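(* Let $\operatorname{char}\mathbb{K}=p>0$, let $n\ge 2$ with $p\mid n$, and suppose $\mathcal{E}_{gh}\ne 0$ in $\overline{\mathcal{T}}_n$. Then $\overline{\mathcal{T}}_n'(p)$ has GK-dimension $p-1$, with a PBW basis $$\{h^{n_2}\mathcal{E}_{\omega_{p-2}}^{n_{\omega_{p-2}}}\mathcal{E}_{\omega_{p-3}}^{n_{\omega_{p-3}}}\cdots\mathcal{E}_{\omega_1}^{n_{\omega_1}}g^{n_1}\mid 0\le n_1\le n-1,\ n_2,n_{\omega_k}\in\mathbb{N},\ 1\le k\le p-2\}$$ satisfying the relations $$g^n=1,\qquad \mathcal{E}_{\omega_s}h=h\mathcal{E}_{\omega_s}+\mathcal{E}_{\omega_{s+1}},\qquad \mathcal{E}_{\omega_{p-2}}h=h\mathcal{E}_{\omega_{p-2}},\qquad \mathcal{E}_{\omega_s}\mathcal{E}_{\omega_t}=\mathcal{E}_{\omega_t}\mathcal{E}_{\omega_s},$$ where $0\le s<t\le p-2$.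
   Context: $\mathbb{K}$ is a field, $\mathbb{N}=\{0,1,2,\ldots\}$, and $[a,b]=ab-ba$. On words in the letters $g,h$ use the lexicographic order with $g\prec h$ (a proper prefix of a word is smaller than the word). A Lyndon word is a nonempty word $\alpha$ which is a single letter or satisfies $\alpha\prec\gamma\beta$ for every factorization $\alpha=\beta\gamma$ into nonempty words. $\alpha(g)$ is the number of occurrences of $g$ in $\alpha$. The standard factorization of a Lyndon word $\alpha$ of length at least $2$ is $\alpha=\beta\gamma$ with $\beta,\gamma$ Lyndon and $\gamma$ of maximal length. Define $E_g=g$, $E_h=h$ and $E_\alpha=[E_\beta,E_\gamma]$ for the standard factorization $\alpha=\beta\gamma$. $\mathcal{T}=\mathbb{K}\langle g,h\rangle$ is the free algebra, and $\overline{\mathcal{T}}=\mathcal{T}/\mathcal{I}$ where $\mathcal{I}$ is the ideal generated by all $E_\alpha$ with $\alpha$ Lyndon and $\alpha(g)\ge 2$. $\overline{\mathcal{T}}_n=\overline{\mathcal{T}}/(g^n-1)$. For $k\ge 0$, $\omega_k=gh^k$, so $E_{\omega_0}=g$, $E_{\omega_1}=E_{gh}=[g,h]$, $E_{\omega_k}=[E_{\omega_{k-1}},h]$; in any quotient of $\mathcal{T}$, $g,h,\mathcal{E}_{\omega_k}$ denote the images of $g,h,E_{\omega_k}$ (so $\mathcal{E}_{\omega_0}=g$, $\mathcal{E}_{gh}=\mathcal{E}_{\omega_1}$). $\overline{\mathcal{T}}_n'(p)=\overline{\mathcal{T}}_n/(\mathcal{E}_{\omega_{p-1}})$. A PBW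 basis means that the displayed ordered monomials form a $\mathbb{K}$-vector space basis. GK-dimension is Gelfand–Kirillov dimension. *)

(* Defs.v *)
From HB Require Import structures.
From mathcomp Require Import all_boot all_order all_algebra.
From mathcomp Require Export monalg.
From mathcomp Require Import boolp classical_sets reals ereal sequences exp.

Set Implicit Arguments.
Unset Strict Implicit.
Unset Printing Implicit Defensive.

Import GRing.Theory Order.Theory.
Import Order.DefaultSeqLexiOrder.

Local Open Scope ring_scope.
Local Open Scope quotient_scope.

Section TwoSidedIdeal.
Variables (K : fieldType) (A : algType K).

(* The two-sided ideal generated by [S] (scalars act through [a *: x =
   (a *: 1) * x], so closure under scaling is automatic). *)
Inductive ideal_gen (S : A -> Prop) : A -> Prop :=
| ideal_mem x : S x -> ideal_gen S x
| ideal_0 : ideal_gen S 0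
| ideal_add x y : ideal_gen S x -> ideal_gen S y -> ideal_gen S (x + y)
| ideal_mull a x : ideal_gen S x -> ideal_gen S (a * x)
| ideal_mulr a x : ideal_gen S x -> ideal_gen S (x * a).

Variable S : A -> Prop.

Lemma ring_hom_ideal (f : {rmorphism A -> K}) :
  (forall x, S x -> f x = 0) -> forall x, ideal_gen S x -> f x = 0.
Proof.
move=> fS x; elim=> {x}; first exact: fS.
- by rewrite rmorph0.
- by move=> x y _ fx _ fy; rewrite rmorphD fx fy addr0.
- by move=> a x _ fx; rewrite rmorphM fx mulr0.
by move=> a x _ fx; rewrite rmorphM fx mul0r.
Qed.

Definition ideal_pred : {pred A} := fun x => `[< ideal_gen S x >].

Lemma ideal_predP x : reflect (ideal_gen S x) (x \in ideal_pred).
Proof. exact: asboolP. Qed.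

Lemma ideal_pred_zmod_closed : zmod_closed ideal_pred.
Proof.
split=> [|x y /ideal_predP Ix /ideal_predP Iy]; apply/ideal_predP.
  exact: ideal_0.
by apply: ideal_add => //; rewrite -mulN1r; apply: ideal_mull.
Qed.

HB.instance Definition _ :=
  GRing.isZmodClosed.Build A ideal_pred ideal_pred_zmod_closed.

(* [algType] requires [1 != 0], hence only quotients by proper ideals. *)
Hypothesis S_proper : ~ ideal_gen S 1.

Definition quot_alg of ~ ideal_gen S 1 := Quotient.quot ideal_pred.
Local Notation Q := (quot_alg S_proper).

HB.instance Definition _ := Choice.on Q.
HB.instance Definition _ := GRing.Zmodule.on Q.

Definition proj (x : A) : Q := \pi_(Quotient.quot ideal_pred) x.

Lemma projP x y : proj x = proj y <-> ideal_gen S (x - y).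
Proof.
split=> [/eqP|Ixy].
  by rewrite /proj -Quotient.idealrBE => /ideal_predP.
by apply/eqP; rewrite /proj -Quotient.idealrBE; apply/ideal_predP.
Qed.

Lemma proj_surj (u : Q) : exists x, proj x = u.
Proof. by exists (repr (u : Quotient.quot ideal_pred)); rewrite /proj reprK. Qed.

Let lift (u : Q) : A := repr (u : Quotient.quot ideal_pred).
Let liftK : cancel lift proj.
Proof. by move=> u; rewrite /proj /lift reprK. Qed.

Lemma proj0 : proj 0 = 0. Proof. by rewrite /proj raddf0. Qed.
Lemma projD : {morph proj : x y / x + y}.
Proof. by move=> x y; rewrite /proj raddfD. Qed.

Definition quot_one : Q := proj 1.
Definition quot_mul (u v : Q) : Q := proj (lift u * lift v).
Definition quot_scale (a : K) (u : Q) : Q := proj (a *: lift u).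

Let lift_proj x : ideal_gen S (lift (proj x) - x).
Proof. by apply/projP; rewrite liftK. Qed.

Let quot_mulE x y : quot_mul (proj x) (proj y) = proj (x * y).
Proof.
apply/projP; set a := lift _; set b := lift _.
have -> : a * b - x * y = (a - x) * b + x * (b - y).
  by rewrite mulrBl mulrBr addrA subrK.
apply: ideal_add.
  exact/ideal_mulr/lift_proj.
exact/ideal_mull/lift_proj.
Qed.

Let quot_scaleE a x : quot_scale a (proj x) = proj (a *: x).
Proof.
apply/projP; rewrite -scalerBr -[lift _ - x]mul1r scalerAl.
exact/ideal_mull/lift_proj.
Qed.

Let quot_ind (P : Q -> Prop) : (forall x, P (proj x)) -> forall u, P u.
Proof. by move=> IH u; rewrite -[u]liftK. Qed.

Let qmulA : associative quot_mul.
Proof.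
by do 3![elim/quot_ind=> ?]; rewrite !quot_mulE mulrA.
Qed.
Let qmul1 : left_id quot_one quot_mul.
Proof. by elim/quot_ind=> x; rewrite quot_mulE mul1r. Qed.
Let qmulr1 : right_id quot_one quot_mul.
Proof. by elim/quot_ind=> x; rewrite quot_mulE mulr1. Qed.
Let qmulDl : left_distributive quot_mul +%R.
Proof.
by do 3![elim/quot_ind=> ?]; rewrite !quot_mulE -!projD quot_mulE mulrDl.
Qed.
Let qmulDr : right_distributive quot_mul +%R.
Proof.
by do 3![elim/quot_ind=> ?]; rewrite !quot_mulE -!projD quot_mulE mulrDr.
Qed.

Let q1_neq0 : quot_one != 0.
Proof.
apply/eqP; rewrite -proj0 => /projP; rewrite subr0.
exact: S_proper.
Qed.

HB.instance Definition _ :=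
  GRing.Zmodule_isNzRing.Build Q qmulA qmul1 qmulr1 qmulDl qmulDr q1_neq0.

Let qscaleA a b u : quot_scale a (quot_scale b u) = quot_scale (a * b) u.
Proof. by elim/quot_ind: u => x; rewrite !quot_scaleE scalerA. Qed.
Let qscale1 : left_id 1 quot_scale.
Proof. by elim/quot_ind=> x; rewrite quot_scaleE scale1r. Qed.
Let qscaleDr : right_distributive quot_scale +%R.
Proof.
by move=> a; do 2![elim/quot_ind=> ?]; rewrite !quot_scaleE -!projD quot_scaleE scalerDr.
Qed.
Let qscaleDl u : {morph quot_scale^~ u : a b / a + b}.
Proof. by move=> a b; elim/quot_ind: u => x; rewrite !quot_scaleE -projD scalerDl. Qed.

HB.instance Definition _ := GRing.Zmodule_isLmodule.Build K Q
  qscaleA qscale1 qscaleDr qscaleDl.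

Let qscaleAl (a : K) (u v : Q) : a *: (u * v) = (a *: u) * v.
Proof.
elim/quot_ind: u => x; elim/quot_ind: v => y.
rewrite -[(_ * _ : Q)]/(quot_mul _ _) -[X in _ = X]/(quot_mul (quot_scale _ _) _).
by rewrite -[LHS]/(quot_scale _ _) !(quot_mulE, quot_scaleE) scalerAl.
Qed.
HB.instance Definition _ := GRing.Lmodule_isLalgebra.Build K Q qscaleAl.
Let qscaleAr (a : K) (u v : Q) : a *: (u * v) = u * (a *: v).
Proof.
elim/quot_ind: u => x; elim/quot_ind: v => y.
rewrite -[(_ * _ : Q)]/(quot_mul _ _) -[X in _ = X]/(quot_mul _ (quot_scale _ _)).
by rewrite -[LHS]/(quot_scale _ _) !(quot_mulE, quot_scaleE) scalerAr.
Qed.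

HB.instance Definition _ := GRing.Lalgebra_isAlgebra.Build K Q qscaleAr.

Lemma projN : {morph proj : x / - x}.
Proof. by move=> x; rewrite /proj raddfN. Qed.
Lemma proj1 : proj 1 = 1. Proof. by []. Qed.
Lemma projM : {morph proj : x y / x * y}.
Proof. by move=> x y; rewrite -quot_mulE. Qed.
Lemma projZ a : {morph proj : x / a *: x}.
Proof. by move=> x; rewrite -quot_scaleE. Qed.

Lemma quot_ring_hom (f : {rmorphism A -> K}) :
  (forall x, S x -> f x = 0) ->
  exists f' : {rmorphism Q -> K}, forall x, f' (proj x) = f x.
Proof.
move=> fS; pose f' (u : Q) := f (lift u).
have f'E x : f' (proj x) = f x.
  by apply/eqP; rewrite -subr_eq0 -rmorphB (ring_hom_ideal fS).
have f'_add : zmod_morphism f'.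
  move=> u v; elim/quot_ind: u => x; elim/quot_ind: v => y.
  by rewrite -projN -projD !f'E rmorphB.
have f'_mul : monoid_morphism f'.
  split; first by rewrite -proj1 f'E rmorph1.
  move=> u v; elim/quot_ind: u => x; elim/quot_ind: v => y.
  by rewrite -projM !f'E rmorphM.
pose F := GRing.isZmodMorphism.Build Q K f' f'_add.
pose G := GRing.isMonoidMorphism.Build Q K f' f'_mul.
by exists (HB.pack f' F G : {rmorphism Q -> K}).
Qed.

End TwoSidedIdeal.

Lemma proper_of_ring_hom (K : fieldType) (A : algType K) (S : A -> Prop)
    (f : {rmorphism A -> K}) :
  (forall x, S x -> f x = 0) -> ~ ideal_gen S 1.
Proof.
by move=> fS /(ring_hom_ideal fS)/eqP; rewrite rmorph1 oner_eq0.
Qed.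

Section GKdim.
Variable K : fieldType.

Definition lin_indep (V : lmodType K) (s : seq V) : Prop :=
  forall c : 'I_(size s) -> K,
    \sum_(i < size s) c i *: s`_i = 0 -> forall i, c i = 0.

(* The dimension of the linear span of [s], as the largest size of a linearly
   independent subsequence. *)
Definition span_dim (V : lmodType K) (s : seq V) : nat :=
  \max_(m : (size s).-tuple bool | `[< lin_indep (mask m s) >]) size (mask m s).

Variable A : algType K.

Fixpoint prods (s : seq A) (i : nat) : seq A :=
  if i is j.+1 then [seq x * y | x <- s, y <- prods s j] else [:: 1].

(* Spans [V^0 + V^1 + ... + V^m], where [V] is the span of [s]. *)
Definition prods_upto (s : seq A) (m : nat) : seq A :=
  flatten [seq prods s i | i <- iota 0 m.+1].

(* sup over the finite-dimensional subspaces [V] of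
   limsup_m log_m dim (V^0 + ... + V^m). *)
Definition GKdim (R : realType) : \bar R :=
  ereal_sup (range (fun s : seq A =>
    limn_esup (fun m =>
      (ln (span_dim (prods_upto s m))%:R / ln m%:R : R)%:E))).

End GKdim.

Definition is_basis (K : fieldType) (V : lmodType K) (I : eqType)
    (b : I -> V) : Prop :=
  (forall (s : seq I) (c : I -> K), uniq s ->
     \sum_(i <- s) c i *: b i = 0 -> forall i, i \in s -> c i = 0) /\
  (forall v : V, exists (s : seq I) (c : I -> K), v = \sum_(i <- s) c i *: b i).

(* The letters are booleans, so that [g < h] is the library order on [bool] and
   [<] on words is the library lexicographic order. *)
Definition letter := bool.
Definition lg : letter := false.
Definition lh : letter := true.
Definition word := seq bool.

(* The factorizations of [w] into two nonempty words are
   [w = take i w ++ drop i w] with [0 < i < size w]. *)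
Definition lyndon (w : word) : bool :=
  (w != [::]) &&
  all (fun i => (w < drop i w ++ take i w)%O) (iota 1 (size w).-1).

Lemma lyndonP (w : word) :
  reflect (w <> [::] /\ forall u v : word, u <> [::] -> v <> [::] ->
             w = u ++ v -> (w < v ++ u)%O)
          (lyndon w).
Proof.
apply: (iffP andP) => [[/eqP w0 /allP H]|[w0 H]]; split=> //; last 1 first.
- apply/allP=> i; rewrite mem_iota => /andP[i0 iw].
  have {}iw : (i < size w)%N by case: (w) w0 iw.
  apply: H; last by rewrite cat_take_drop.
    by move/(congr1 size); rewrite size_take iw /= => i00; rewrite i00 in i0.
  by move/(congr1 size)/eqP; rewrite size_drop /= subn_eq0 leqNgt iw.
- move=> u v u0 v0 wE; have := H (size u); rewrite wE drop_size_cat // take_size_cat //.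
  apply; rewrite mem_iota size_cat; case: u v u0 v0 {wE} => [|a u] [|b v] //= _ _.
  by rewrite addnS add1n /= !ltnS leq_addr.
exact/eqP.
Qed.

Definition is_std_fact (w u v : word) : Prop :=
  [/\ w = u ++ v, lyndon u, lyndon v &
      forall u' v' : word, w = u' ++ v' -> lyndon u' -> lyndon v' ->
        (size v' <= size v)%N].

(* [v] of maximal length means [u] of minimal length. *)
Definition std_split (w : word) : nat :=
  find (fun i => lyndon (take i w) && lyndon (drop i w)) (iota 0 (size w)).


Lemma std_split_gt0 w : (1 < size w)%N -> (0 < std_split w)%N.
Proof. by case: w => [|x w]. Qed.

Lemma free_alg_scalerAr (K : fieldType) (a : K) 
    (x y : {malg K[{fmonom bool}]}) :
  a *: (x * y) = x * (a *: y).
Proof.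
have ax : a%:MP * x = x * a%:MP.
  rewrite mul_malgC malgM_def fgmulgU malgZ_def.
  by apply/eq_bigr=> k _; rewrite mulrC mulm1.
rewrite -(mul_malgC a (x * y)) -(mul_malgC a y) mulrA ax mulrA.
reflexivity.
Qed.

(* [malg] carries an [algType] structure only over commutative monoids. *)
Definition free_alg (K : fieldType) := {malg K[{fmonom bool}]}.

Definition commutator (A : nzRingType) (x y : A) : A := x * y - y * x.

Lemma commutator0 (A : nzRingType) (x : A) : commutator x 0 = 0.
Proof. by rewrite /commutator mulr0 mul0r subrr. Qed.

Lemma rmorph_commutator (A : nzRingType) (F : fieldType)
    (f : {rmorphism A -> F}) x y : f (commutator x y) = 0.
Proof. by rewrite rmorphB !rmorphM mulrC subrr. Qed.

Section FreeAlgebra.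
Variable K : fieldType.

HB.instance Definition _ := GRing.Lalgebra.on (free_alg K).

HB.instance Definition _ :=
  GRing.Lalgebra_isAlgebra.Build K (free_alg K)
    (@free_alg_scalerAr K).

Definition gen (x : letter) : free_alg K := << fmu x >>.

(* The argument [k] only bounds the recursion depth, see [bracketE]. *)
Fixpoint bracket_rec (k : nat) (w : word) : free_alg K :=
  if w is [:: x] then gen x else
  if k is k'.+1 then
    let i := std_split w in
    commutator (bracket_rec k' (take i w)) (bracket_rec k' (drop i w))
  else 0.

(* [E_w], for Lyndon [w]. *)
Definition bracket (w : word) : free_alg K := bracket_rec (size w) w.

Lemma bracket1 x : bracket [:: x] = gen x.
Proof. by []. Qed.

Lemma bracket_rec_nil k : bracket_rec k [::] = 0.
Proof. by elim: k => //= k IH; rewrite /commutator subrr. Qed.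

Lemma bracket_recS k w : (1 < size w)%N ->
  bracket_rec k.+1 w = commutator (bracket_rec k (take (std_split w) w))
                                  (bracket_rec k (drop (std_split w) w)).
Proof. by case: w => [|x [|y w]]. Qed.

Lemma bracket_rec_depth w k1 k2 : (size w <= k1)%N -> (size w <= k2)%N ->
  bracket_rec k1 w = bracket_rec k2 w.
Proof.
elim: {w}(size w) {-2}w (leqnn (size w)) k1 k2 => [|m IH] w.
  by rewrite leqn0 size_eq0 => /eqP-> k1 k2; rewrite !bracket_rec_nil.
have [w1|w1] := leqP (size w) 1.
  case: w w1 => [|x [|//]] _ _ k1 k2; first by rewrite !bracket_rec_nil.
  by case: k1; case: k2.
move=> wm [|k1] [|k2] wk1 wk2.
- by move: (leq_trans w1 wk1).
- by move: (leq_trans w1 wk1).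
- by move: (leq_trans w1 wk2).
rewrite (bracket_recS k1 w1) (bracket_recS k2 w1); set i := std_split w.
have [iw|wi] := ltnP i (size w); last first.
  by rewrite (drop_oversize wi) !bracket_rec_nil !commutator0.
have st : (size (take i w) < size w)%N by rewrite size_take iw.
have sd : (size (drop i w) < size w)%N by rewrite size_drop ltn_subrL std_split_gt0 // ltnW.
have le (u : word) (k : nat) : (size u < size w)%N -> (size w <= k.+1)%N ->
    (size u <= k)%N by move=> uw wk; rewrite -ltnS (leq_trans uw wk).
rewrite (IH _ (le _ _ st wm) k1 k2 (le _ _ st wk1) (le _ _ st wk2)).
by rewrite (IH _ (le _ _ sd wm) k1 k2 (le _ _ sd wk1) (le _ _ sd wk2)).
Qed.

Lemma bracketE w u v :
  is_std_fact w u v -> bracket w = commutator (bracket u) (bracket v).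
Proof.
case=> wE Lu Lv vmax.
have u0 : (0 < size u)%N by case: (u) Lu.
have v0 : (0 < size v)%N by case: (v) Lv.
have sw : size w = (size u + size v)%N by rewrite wE size_cat.
have uw : (size u < size w)%N by rewrite sw -[X in (X < _)%N]addn0 ltn_add2l.
have spu : lyndon (take (size u) w) && lyndon (drop (size u) w).
  by rewrite wE take_size_cat // drop_size_cat // Lu.
have iu : (std_split w <= size u)%N.
  rewrite leqNgt; apply/negP=> /(before_find 0%N).
  by rewrite nth_iota // add0n spu.
have iw : (std_split w < size w)%N := leq_ltn_trans iu uw.
have hs : has (fun i => lyndon (take i w) && lyndon (drop i w))
              (iota 0 (size w)).
  by rewrite has_find size_iota.
have iE : std_split w = size u.
  apply/eqP; rewrite eqn_leq iu /=.
  have /andP[Lt Ld] := nth_find 0%N hs.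
  rewrite -/(std_split w) nth_iota // add0n in Lt Ld.
  have := vmax _ _ (esym (cat_take_drop _ w)) Lt Ld.
  by rewrite size_drop leq_subLR sw leq_add2r.
have w1 : (1 < size w)%N by exact: leq_ltn_trans u0 uw.
have sS : size w = (size w).-1.+1 by rewrite prednK // ltnW.
rewrite /bracket sS (bracket_recS _ w1) iE.
have -> : take (size u) w = u by rewrite wE take_size_cat.
have -> : drop (size u) w = v by rewrite wE drop_size_cat.
have ku : (size u <= (size w).-1)%N by rewrite -ltnS -sS.
have kv : (size v <= (size w).-1)%N.
  by rewrite -ltnS -sS sw -[X in (X < _)%N]add0n ltn_add2r.
rewrite (bracket_rec_depth ku (leqnn _)) (bracket_rec_depth kv (leqnn _)).
exact: erefl.
Qed.

(* Specializing both variables to 1 shows that the ideals below are proper. *)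
Definition const1 (_ : {fmonom bool}) : K := 1.
Lemma const1_mmorphism : mmorphism const1.
Proof. by split=> // x y; rewrite mulr1. Qed.
HB.instance Definition _ := isMultiplicative.Build _ K const1 const1_mmorphism.

Definition aug : {rmorphism free_alg K -> K} := mmap idfun const1.

Lemma aug_commutator x y : aug (commutator x y) = 0.
Proof. exact: rmorph_commutator. Qed.

Lemma aug_gen x : aug (gen x) = 1.
Proof. by rewrite /aug /gen /= mmapU mulr1. Qed.

Lemma aug_bracket w : (1 < size w)%N -> aug (bracket w) = 0.
Proof. by case: w => [|x [|y w]] // _; exact: aug_commutator. Qed.

End FreeAlgebra.

(* [omega k] is the word [g h^k]. *)
Definition omega (k : nat) : word := lg :: nseq k lh.

Lemma lyndon_omega k : lyndon (omega k).
Proof.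
apply/lyndonP; split=> // u v u0 v0 uv.
have : all (pred1 lh) v.
  case: u u0 uv => // x u _ [_ /(congr1 (all (pred1 lh)))].
  by rewrite all_nseq orbT all_cat => /esym/andP[].
by case: v v0 {uv} => // y v _ /= /andP[/eqP-> _].
Qed.

Lemma omega_std_fact k : is_std_fact (omega k.+1) (omega k) [:: lh].
Proof.
split=> //; first by rewrite /omega -[k.+1]addn1 nseqD.
  exact: lyndon_omega.
move=> u' v' E Lu Lv; have {u' Lu E} : all (pred1 lh) v'.
  case: u' Lu E => // x u _ [_ /(congr1 (all (pred1 lh)))].
  by rewrite -[_ :: _]/(nseq k.+1 lh) all_nseq orbT all_cat => /esym/andP[].
case: v' Lv => [|x [|y v]] // /lyndonP[_ L] a1.
have a2 : all (pred1 lh) ((y :: v) ++ [:: x]).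
  by move: a1; rewrite all_cat /= => /and3P[-> -> ->].
have e : (y :: v) ++ [:: x] = [:: x, y & v].
  rewrite (elimT (all_pred1P _ _) a2) [RHS](elimT (all_pred1P _ _) a1).
  by rewrite size_cat addn1.
have x0 : [:: x] <> [::] by [].
have yv0 : y :: v <> [::] by [].
by have := L _ _ x0 yv0 erefl; rewrite e ltxx.
Qed.

Lemma bracket_omegaS (K : fieldType) k :
  bracket K (omega k.+1) = commutator (bracket K (omega k)) (bracket K [:: lh]).
Proof. exact: bracketE (omega_std_fact k). Qed.

Section Quotients.
Variable K : fieldType.

Definition Tbar_rel (x : free_alg K) : Prop :=
  exists2 w, lyndon w && (2 <= count_mem lg w)%N & x = bracket K w.

Lemma Tbar_rel_aug x : Tbar_rel x -> aug K x = 0.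
Proof.
case=> w /andP[_ cw] ->; apply: aug_bracket.
exact: leq_trans cw (count_size _ _).
Qed.

Definition Tbar_proper : ~ ideal_gen Tbar_rel 1 :=
  proper_of_ring_hom Tbar_rel_aug.

Definition Tbar : algType K := quot_alg Tbar_proper.
Definition to_Tbar : free_alg K -> Tbar := proj Tbar_proper.

Variable n : nat.

Definition Tbarn_rel (x : Tbar) : Prop := x = to_Tbar (gen K lg) ^+ n - 1.

Lemma Tbarn_aug : exists f : {rmorphism Tbar -> K},
  (forall x, f (to_Tbar x) = aug K x) /\ (forall u, Tbarn_rel u -> f u = 0).
Proof.
have [f fE] := quot_ring_hom Tbar_proper Tbar_rel_aug; exists f; split=> // u ->.
by rewrite rmorphB rmorphXn rmorph1 fE aug_gen expr1n subrr.
Qed.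

Lemma Tbarn_proper : ~ ideal_gen Tbarn_rel 1.
Proof. by have [f [_ fr]] := Tbarn_aug; exact: proper_of_ring_hom fr. Qed.

Definition Tbarn : algType K := quot_alg Tbarn_proper.
Definition to_Tbarn (x : free_alg K) : Tbarn := proj Tbarn_proper (to_Tbar x).

Variables (p : nat) (p_prime : prime p).

Definition Tbarn'_rel (x : Tbarn) : Prop := x = to_Tbarn (bracket K (omega p.-1)).

Lemma Tbarn'_proper : ~ ideal_gen Tbarn'_rel 1.
Proof.
have [f [fE fr]] := Tbarn_aug; have [f' f'E] := quot_ring_hom Tbarn_proper fr.
apply: (proper_of_ring_hom (f := f')) => u ->; rewrite f'E fE aug_bracket //.
by case: p p_prime => [|[|q]] //=; rewrite size_nseq.
Qed.

Definition Tbarn' : algType K := quot_alg Tbarn'_proper.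
Definition to_Tbarn' (x : free_alg K) : Tbarn' :=
  proj Tbarn'_proper (to_Tbarn x).

End Quotients.

(* Main.v *)
Require Import Defs.
From HB Require Import structures.
From mathcomp Require Import all_boot all_order all_algebra.
From mathcomp Require Import mpoly ring.
From mathcomp Require Import boolp classical_sets reals ereal sequences exp.

Set Implicit Arguments.
Unset Strict Implicit.
Unset Printing Implicit Defensive.

Import Order.TTheory GRing.Theory Num.Theory.
Local Open Scope ring_scope.

(** The algebra is an Ore extension [C[h; D]] of the commutative algebra
[C = K[x_0, ..., x_(p-2)] / (x_0^n - 1)], where [x_s] is the class of
[E_(omega s)] and the derivation [D] sends [x_s] to [x_(s+1)] and [x_(p-2)]
to [0].  It exists because [D (x_0^n - 1) = n x_0^(n-1) x_1] vanishes when
[p] divides [n]; the monomials of [C[h]], with [h] on the left, are the PBW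
basis.

Relations.  For [s < t] the word [omega s ++ omega t] is Lyndon with standard
factors [omega s] and [omega t], so that its bracket is the commutator of
[E_(omega s)] and [E_(omega t)], and it is killed in the quotient
([omega_pair_std_fact], [E_comm]).  The relation of [E_(omega s)] with [h] is
the recursive definition of [E_(omega (s+1))].

Spanning.  Moving an [h] to the left through a product of [E]'s replaces the
product by products of the same length with one index raised.  So the elements
[h^i E_(s_1) ... E_(s_l)] with [i + l <= d] span the [d]-th layer of a
multiplicative exhaustive filtration ([filtM], [filt_exhaustive]), and
commutativity of the [E]'s turns each of them into a PBW monomial
([mono_pbw]).

Independence.  The free algebra acts from the right on the polynomial ring
[P = K[x_0, ..., x_(p-2), y]]: [g] multiplies by [x_0] and [h] acts as
multiplication by [y] plus [D].  Then [E_(omega s)] multiplies by [x_s], hence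
by [0] for [s = p - 1]; and the bracket of a Lyndon word with at least two
[g]'s acts as [0], since it is built from commutators of two such
multiplications ([act_bracket_two_g]).  The elements that map [P] into
[(x_0^n - 1) P] form a two-sided ideal because [D (x_0^n - 1) = 0].  It contains
all the relations, hence the kernel of the projection onto the quotient
([to_Tbarn'_annihilator]).  A PBW monomial sends [1] to the corresponding
monomial of [P], of degree less than [n] in [x_0], and no nonzero combination
of such monomials is a multiple of [x_0^n - 1] ([pbw_poly_indep]).

Growth.  The [d]-th layer lies in the span of the [n (d+1)^(p-1)] PBW
monomials whose unbounded exponents are at most [d], so that
[V^0 + ... + V^M] has dimension [O(M^(p-1))] for each finite-dimensional [V].
Conversely, if [V] is spanned by [h], the [E_(omega k)] and the powers of [g],
then [V^0 + ... + V^M] contains at least [(M/(p-1))^(p-1)] of these monomials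
([GKdim_pbw]). *)

(** * Independent families and growth *)

Section SpanDim.
Variables (K : fieldType) (V : lmodType K) (I : eqType) (b : I -> V).

(** If [t] were longer than [e], the matrix of coordinates of [t] on the
family indexed by [e] would have more rows than columns, hence a nontrivial
left kernel, which is a linear relation on [t]. *)
Lemma lin_indep_size (e : seq I) (t : seq V) : lin_indep t ->
  (forall x, x \in t -> exists c : I -> K, x = \sum_(i <- e) c i *: b i) ->
  (size t <= size e)%N.
Proof.
move=> ti te.
have {}te (i : 'I_(size t)) :
    exists c : I -> K, t`_i = \sum_(j <- e) c j *: b j.
  by apply: te; apply: mem_nth.
have [c tE] := choice te.
pose M := \matrix_(i < size t, j < size e) c i (tnth (in_tuple e) j).
suff /eqP <- : row_free M by apply: rank_leq_col.
apply: inj_row_free => r rM; apply/rowP => i; rewrite mxE.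
apply: (ti (fun i => r 0 i)).
under eq_bigr do rewrite tE big_tnth scaler_sumr.
rewrite exchange_big big1 //= => j _.
have /rowP/(_ j) := rM; rewrite !mxE => rMj.
under eq_bigr do rewrite scalerA.
rewrite -scaler_suml -[X in X *: _](_ : \sum_k r 0 k * M k j = _).
  by rewrite rMj scale0r.
by apply: eq_bigr => k _; rewrite mxE.
Qed.

Lemma span_dim_le (e : seq I) (s : seq V) :
  (forall x, x \in s -> exists c : I -> K, x = \sum_(i <- e) c i *: b i) ->
  (span_dim s <= size e)%N.
Proof.
move=> se; apply/bigmax_leqP => k /asboolP ki.
by apply: lin_indep_size ki _ => x /mem_mask; apply: se.
Qed.

Hypothesis b_basis : is_basis b.

Lemma basis_inj : injective b.
Proof.
move=> i j bij; apply/eqP/negPn/negP => ij.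
have uij : uniq [:: i; j] by rewrite /= inE ij.
have := b_basis.1 [:: i; j] (fun k => if k == i then 1 else -1) uij.
rewrite !big_cons big_nil eqxx eq_sym (negPf ij) bij scale1r scaleN1r addr0.
rewrite subrr => /(_ erefl i (mem_head _ _)) /eqP.
by rewrite eqxx oner_eq0.
Qed.

Lemma basis_lin_indep (e : seq I) : uniq e -> lin_indep (map b e).
Proof.
move=> ue c c0; pose x k := tnth (in_tuple e) (cast_ord (size_map b e) k).
pose c' i := oapp c 0 (insub (index i e)).
have xE k : index (x k) e = k.
  rewrite /x (tnth_nth (x k)) /= index_uniq //.
  by rewrite -[X in (_ < X)%N](size_map b).
have c'E k : c' (x k) = c k by rewrite /c' xE valK.
have bx (k : 'I_(size (map b e))) : (map b e)`_k = b (x k).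
  rewrite (nth_map (x k)) -?[X in (_ < X)%N](size_map b) //.
  by rewrite {2}/x (tnth_nth (x k)).
have e0 : \sum_(i <- e) c' i *: b i = 0.
  rewrite -[RHS]c0 big_tnth (reindex (cast_ord (size_map b e))) /=; last first.
    exists (cast_ord (esym (size_map b e))) => k _; first exact: cast_ordK.
    exact: cast_ordKV.
  by apply: eq_bigr => k _; rewrite c'E bx.
by move=> k; rewrite -c'E; apply: b_basis.1 e0 _ _ => //; apply: mem_tnth.
Qed.

(** [span_dim] is a maximum over the subsequences of [s].  The elements of the
image of [e], each taken at its first occurrence in [s], form an independent
subsequence. *)
Lemma span_dim_ge (e : seq I) (s : seq V) : uniq e ->
  (forall i, i \in e -> b i \in s) -> (size e <= span_dim s)%N.
Proof.
move=> ue es.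
pose t := [seq x <- undup s | x \in map b e].
have ts : subseq t s := subseq_trans (filter_subseq _ _) (undup_subseq s).
have tp : perm_eq t (map b e).
  apply: uniq_perm; first exact/filter_uniq/undup_uniq.
    by rewrite map_inj_uniq //; exact: basis_inj.
  move=> x; rewrite mem_filter mem_undup andb_idr // => /mapP[i ie ->].
  exact: es.
have [e' te'] : exists e', t = map b e'.
  have: all (mem (map b e)) t by apply: filter_all.
  elim: t {ts tp} => [|x t IH] /=; first by exists [::].
  by case/andP=> /mapP[i _ ->] /IH[e' ->]; exists (i :: e').
have ue' : uniq e'.
  apply: (@map_uniq _ _ b); rewrite -te'; exact/filter_uniq/undup_uniq.
have/subseqP[k sk tk] := ts.
have sz : size (mask k s) = size e by rewrite -tk (perm_size tp) size_map.
have ks : size k == size s by apply/eqP.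
rewrite -sz; apply: (leq_bigmax_cond (Tuple ks)) => /=.
by apply/asboolP; rewrite -tk te'; apply: basis_lin_indep.
Qed.
End SpanDim.

Section Growth.
Local Open Scope classical_set_scope.
Variable R : realType.
Implicit Types (u : nat -> nat) (k N M : nat).
Local Notation logratio u := (fun M => (ln (u M)%:R / ln M%:R : R)%:E).

Lemma ln_nat_large (c : R) : exists M0, forall M, (M0 <= M)%N -> c <= ln M%:R.
Proof.
exists (Num.truncn (expR c)).+1 => M hM.
rewrite -[c]expRK ler_ln ?posrE ?expR_gt0 //; last first.
  by rewrite ltr0n (leq_trans _ hM).
by rewrite (le_trans (ltW (truncnS_gt _))) // ler_nat.
Qed.

(** A constant factor [N] contributes [ln N / ln M], which tends to [0]. *)
Lemma limn_esup_ln_le u k N : (0 < N)%N ->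
  (forall M, (0 < M)%N -> (u M <= N * M ^ k)%N) ->
  (limn_esup (logratio u) <= k%:R%:E)%E.
Proof.
move=> N0 uN; apply/lee_addgt0Pr => e e0.
(* From [M0] on, [ln M] is positive and [ln N / ln M <= e]. *)
have [M0 M0P] := ln_nat_large (Num.max (1 : R) (ln N%:R / e)).
pose tail := [set M | (maxn 1 M0 <= M)%N].
apply: (@le_trans _ _ (ereal_sup [set logratio u M | M in tail])).
  apply: ereal_inf_lbound; exists tail => //.
  by exists (maxn 1 M0).
apply: ge_ereal_sup => _ [M /= M0M <-]; rewrite -EFinD lee_fin.
move: M0M; rewrite /tail /= geq_max => /andP[M1 /M0P].
rewrite ge_max => /andP[l1 lN].
have lM : 0 < ln M%:R :> R by apply: lt_le_trans l1.
rewrite ler_pdivrMr //.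
have M0' : 0 < (M%:R : R) by rewrite ltr0n.
have NM : ln (N * M ^ k)%N%:R = ln N%:R + k%:R * ln M%:R :> R.
  rewrite natrM lnM ?posrE ?ltr0n ?expn_gt0 ?M1 // natrX lnXn //.
  by rewrite mulr_natl.
apply: (@le_trans _ _ (ln (N * M ^ k)%N%:R)); last first.
  by rewrite NM mulrDl addrC lerD2l mulrC -ler_pdivrMr.
have [->|u0] := posnP (u M).
  by rewrite ln0 // ln_ge0 // ler1n muln_gt0 N0 expn_gt0 M1.
by rewrite ler_ln ?posrE ?ltr0n ?muln_gt0 ?N0 ?expn_gt0 ?M1 // ler_nat uN.
Qed.

Lemma limn_esup_ln_ge u k N : (0 < N)%N ->
  (forall M, (0 < M)%N -> (M ^ k <= N * u M)%N) ->
  (k%:R%:E <= limn_esup (logratio u))%E.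
Proof.
move=> N0 uN; apply/lee_addgt0Pr => e e0.
rewrite -leeBlDr // -EFinB; apply: le_ereal_inf_tmp => _ [V [M1 _ VM1] <-].
have [M0 M0P] := ln_nat_large (Num.max (1 : R) (ln N%:R / e)).
pose M := maxn 1 (maxn M0 M1).
have MV : V M by apply: VM1; rewrite /= /M !leq_max leqnn !orbT.
apply: (@le_trans _ _ (logratio u M)); last first.
  by apply: ereal_sup_ubound; exists M.
rewrite lee_fin.
have M1' : (0 < M)%N by rewrite /M leq_max.
have: (M0 <= M)%N by rewrite /M !leq_max leqnn orbT.
move=> /M0P; rewrite ge_max => /andP[l1 lN].
have lM : 0 < ln M%:R :> R by apply: lt_le_trans l1.
have uM0 : (0 < u M)%N.
  by have := uN _ M1'; case: (u M) => //; rewrite muln0 leqNgt expn_gt0 M1'.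
rewrite ler_pdivlMr // mulrBl lerBlDr.
apply: (@le_trans _ _ (ln (N * u M)%N%:R)).
  rewrite mulr_natl -lnXn ?ltr0n // -natrX.
  by rewrite ler_ln ?posrE ?ltr0n ?muln_gt0 ?N0 ?expn_gt0 ?M1' // ler_nat uN.
by rewrite natrM lnM ?posrE ?ltr0n // addrC lerD2l mulrC -ler_pdivrMr.
Qed.

(** One [s] whose powers grow at least as fast as [M^k] bounds the supremum
from below; the limits superior over all [s] bound it from above. *)
Lemma GKdim_polynomial_growth (K : fieldType) (A : algType K) k :
  (forall s : seq A, exists2 N, (0 < N)%N &
     forall M, (0 < M)%N -> (span_dim (prods_upto s M) <= N * M ^ k)%N) ->
  (exists (s : seq A) N, (0 < N)%N /\
     forall M, (0 < M)%N -> (M ^ k <= N * span_dim (prods_upto s M))%N) ->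
  GKdim A R = k%:R%:E.
Proof.
move=> ub [s [N [N0 lb]]]; apply/eqP; rewrite eq_le; apply/andP; split.
  apply: ge_ereal_sup => _ [r _ <-]; have [N' N'0 rN'] := ub r.
  exact: limn_esup_ln_le N'0 rN'.
apply: le_trans (limn_esup_ln_ge N0 lb) _.
by apply: ereal_sup_ubound; exists s.
Qed.
End Growth.

(** * Spanning by PBW monomials *)

Section PBWSpan.
Variables (K : fieldType) (A : algType K) (m n : nat) (h : A) (E : nat -> A).
Hypothesis n_gt0 : (0 < n)%N.
Hypothesis EC : forall s t, E s * E t = E t * E s.
Hypothesis Eh : forall s, E s * h = h * E s + E s.+1.
Hypothesis E_top : E m.+1 = 0.
Hypothesis E0n : E 0 ^+ n = 1.

(** The exponent of [E_0] is bounded, which is why it is kept apart from those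
of [E_1, ..., E_m]. *)
Definition pbw (t : nat * {ffun 'I_m -> nat} * 'I_n) : A :=
  h ^+ t.1.1 * (\prod_(j <- rev (enum 'I_m)) E j.+1 ^+ t.1.2 j) * E 0 ^+ t.2.

(** Products are indexed by lists of indices, rather than by exponents, because
commuting [h] past such a product raises one entry of the list at a time. *)
Definition Eprod (l : seq nat) : A := \prod_(s <- l) E s.

Lemma Eprod_cons s l : Eprod (s :: l) = E s * Eprod l.
Proof. exact: big_cons. Qed.

(** Once [E_s = 0], the relation [E_s h = h E_s + E_(s+1)] gives
[E_(s+1) = 0]. *)
Lemma E_gt s : (m < s)%N -> E s = 0.
Proof.
move=> /subnK <-; elim: (s - m.+1)%N => [|k IH] //.
rewrite addSn; have := Eh (k + m.+1); rewrite IH mul0r mulr0 add0r.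
by move=> <-.
Qed.

Lemma EEprodC s l : E s * Eprod l = Eprod l * E s.
Proof. by apply: commr_prod => t _; apply: EC. Qed.

Lemma Eprod_perm l1 l2 : perm_eq l1 l2 -> Eprod l1 = Eprod l2.
Proof.
elim: l1 l2 => [|s l1 IH] l2; first by move=> /perm_size /esym /size0nil ->.
move=> sl; have sl2 : s \in l2 by rewrite -(perm_mem sl) mem_head.
case/splitPr: sl2 sl => a b sl.
have {}sl : perm_eq l1 (a ++ b).
  by rewrite -(perm_cons s) (perm_trans sl) // -cat1s perm_catCA.
rewrite Eprod_cons (IH _ sl) /Eprod !big_cat big_cons /=.
by rewrite !mulrA; congr (_ * _); apply: EEprodC.
Qed.

Lemma Eprod_nseq k s : Eprod (nseq k s) = E s ^+ k.
Proof. by rewrite /Eprod big_nseq -Monoid.iteropE. Qed.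

Definition exponent (i : nat) (l : seq nat) : nat * {ffun 'I_m -> nat} * 'I_n :=
  (i, [ffun j : 'I_m => count_mem j.+1 l],
   Ordinal (ltn_pmod (count_mem 0%N l) n_gt0)).

(** By commutativity the list may be sorted by decreasing index, and the power
of [E_0] may be reduced modulo [n]. *)
Lemma mono_pbw i l : all (fun s => (s <= m)%N) l ->
  h ^+ i * Eprod l = pbw (exponent i l).
Proof.
move=> lm; rewrite /pbw /= -mulrA; congr (_ * _).
rewrite (expr_mod _ E0n).
under eq_bigr do rewrite ffunE -Eprod_nseq.
rewrite -Eprod_nseq -[X in X * _](big_map _ xpredT Eprod) -big_flatten.
rewrite -[RHS]big_cat; apply/Eprod_perm/allP => s _ /=; rewrite count_cat.
rewrite count_flatten -map_comp map_rev sumn_rev sumnE big_map big_enum /=.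
under eq_bigr do rewrite count_nseq /=.
rewrite count_nseq /=; case: s => [|s].
  by rewrite big1 // add0n mul1n.
rewrite mul0n addn0; have [sm|ms] := ltnP s m.
  rewrite (bigD1 (Ordinal sm)) //= eqxx mul1n big1 ?addn0 // => j.
  by rewrite -val_eqE eqSS => /negPf /= ->.
rewrite big1 => [|j _]; last by rewrite eqSS ltn_eqF ?(leq_trans _ ms).
by apply/eqP/count_memPn/negP => /(allP lm); rewrite ltnNge ms.
Qed.

(** The filtration by total degree in [h] and in all the [E_s]. *)
Inductive filt (d : nat) : A -> Prop :=
| filt_mono i l : (i + size l <= d)%N -> filt d (h ^+ i * Eprod l)
| filt0 : filt d 0
| filtD x y : filt d x -> filt d y -> filt d (x + y)
| filtZ c x : filt d x -> filt d (c *: x).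

Lemma filt_leq d e x : (d <= e)%N -> filt d x -> filt e x.
Proof.
move=> de; elim=> {x} [i l il|||]; try by constructor.
by apply: filt_mono; apply: leq_trans de.
Qed.

Lemma filt_mulE d s x : filt d x -> filt d.+1 (x * E s).
Proof.
elim=> {x} [i l il||x y _ Fx _ Fy|c x _ Fx].
- rewrite -mulrA -EEprodC -Eprod_cons; apply: filt_mono => /=.
  by rewrite addnS ltnS.
- by rewrite mul0r; apply: filt0.
- by rewrite mulrDl; apply: filtD.
- by rewrite -scalerAl; apply: filtZ.
Qed.

(** Moving [h] to the left through [E_(s_1) ... E_(s_l)] produces, besides the
product with [h] in front, one product of the same length for each factor, so
the degree grows by one only. *)
Lemma filt_mulh d x : filt d x -> filt d.+1 (x * h).
Proof.
elim=> {x} [i l il||x y _ Fx _ Fy|c x _ Fx].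
- rewrite -mulrA.
  have [L [Ls ->]] : exists L : seq (seq nat),
      all (fun l' => size l' == size l) L /\
      Eprod l * h = h * Eprod l + \sum_(l' <- L) Eprod l'.
    elim: l {il} => [|s l [L [Ls IH]]].
      by exists [::]; rewrite /Eprod !big_nil mul1r mulr1 addr0.
    exists ((s.+1 :: l) :: map (cons s) L); split.
      by rewrite /= eqxx all_map.
    rewrite !Eprod_cons -mulrA IH mulrDr [E s * (h * _)]mulrA Eh mulrDl.
    rewrite big_cons Eprod_cons big_map -addrA mulrA mulr_sumr.
    congr (_ + (_ + _)).
    by apply: eq_bigr => l' _; rewrite Eprod_cons.
  rewrite mulrDr mulrA -exprSr; apply: filtD; first exact: filt_mono.
  elim: L Ls => [|l' L IH] /=.
    by rewrite big_nil mulr0 => _; apply: filt0.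
  case/andP=> /eqP ll' Ls; rewrite big_cons mulrDr.
  apply: filtD; last exact: IH.
  by apply: filt_mono; rewrite ll' ltnW.
- by rewrite mul0r; apply: filt0.
- by rewrite mulrDl; apply: filtD.
- by rewrite -scalerAl; apply: filtZ.
Qed.

Lemma filtM d e x y : filt d x -> filt e y -> filt (d + e) (x * y).
Proof.
move=> Fx; elim=> {y} [i l il||y z _ Fy _ Fz|c y _ Fy].
- have Fi : filt (d + i) (x * h ^+ i).
    elim: i {il} => [|i IH]; first by rewrite mulr1 addn0.
    by rewrite exprSr mulrA addnS; apply: filt_mulh.
  apply: (@filt_leq (d + i + size l)); first by rewrite -addnA leq_add2l.
  rewrite mulrA; move: (d + i)%N (x * _) Fi => {il}.
  elim: l => [|s l IH] k z Fz; first by rewrite /Eprod big_nil mulr1 addn0.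
  by rewrite Eprod_cons mulrA /= addnS -addSn; apply: IH; apply: filt_mulE.
- by rewrite mulr0; apply: filt0.
- by rewrite mulrDr; apply: filtD.
- by rewrite -scalerAr; apply: filtZ.
Qed.

(** A family of exponents large enough for the monomials to span the layer of
degree [d], and whose size is a polynomial of the right degree in [d]. *)
Definition box (d : nat) : seq (nat * {ffun 'I_m -> nat} * 'I_n) :=
  [seq (x.1.1 : nat, [ffun j => x.1.2 j : nat], x.2)
     | x : 'I_d.+1 * {ffun 'I_m -> 'I_d.+1} * 'I_n].

Lemma size_box d : size (box d) = (d.+1 ^ m.+1 * n)%N.
Proof.
by rewrite size_map -cardE !card_prod card_ffun !card_ord expnS.
Qed.

Lemma box_uniq d : uniq (box d).
Proof.
rewrite map_inj_uniq ?enum_uniq //.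
move=> [[i f] b] [[i' f'] b'] /= [/val_inj -> ff' ->].
congr (_, _, _); apply/ffunP => j; apply/val_inj.
by have := congr1 (fun f : {ffun _} => f j) ff'; rewrite !ffunE.
Qed.

Lemma mem_box d (t : nat * {ffun 'I_m -> nat} * 'I_n) :
  (t.1.1 <= d)%N -> (forall j, (t.1.2 j <= d)%N) -> t \in box d.
Proof.
case: t => [[i f] b] /= id fd; apply/mapP.
exists (inord i, [ffun j => inord (f j)], b); first by rewrite mem_enum.
congr (_, _, _); first by rewrite /= inordK.
by apply/ffunP => j; rewrite !ffunE inordK ?ltnS.
Qed.

Lemma filt_box d x : filt d x ->
  exists c : _ -> K, x = \sum_(t <- box d) c t *: pbw t.
Proof.
elim=> {x} [i l il||x y _ [a xa] _ [b yb]|c x _ [a xa]].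
- have [lm|/allPn[s sl sm]] := boolP (all (fun s => (s <= m)%N) l); last first.
    exists (fun=> 0); rewrite big1 => [|t _]; last by rewrite scale0r.
    rewrite (Eprod_perm (perm_to_rem sl)) Eprod_cons E_gt ?ltnNge //.
    by rewrite mul0r mulr0.
  rewrite mono_pbw //; set t0 := exponent i l.
  have t0d : t0 \in box d.
    apply: mem_box => [|j] /=; first by rewrite (leq_trans _ il) ?leq_addr.
    rewrite ffunE (leq_trans (count_size _ _)) // (leq_trans _ il) //.
    exact: leq_addl.
  exists (fun t => (t == t0)%:R).
  rewrite (bigD1_seq t0) ?box_uniq //= eqxx scale1r big1 ?addr0 // => t.
  by move/negPf=> ->; rewrite scale0r.
- by exists (fun=> 0); rewrite big1 // => t _; rewrite scale0r.
- exists (fun t => a t + b t); rewrite xa yb -big_split; apply: eq_bigr => t _.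
  by rewrite scalerDl.
- exists (fun t => c * a t); rewrite xa scaler_sumr; apply: eq_bigr => t _.
  by rewrite scalerA.
Qed.

End PBWSpan.

Lemma rmorph_pbw (K : fieldType) (A B : algType K) (f : {rmorphism A -> B})
    m n h E (t : nat * {ffun 'I_m -> nat} * 'I_n) :
  f (pbw h E t) = pbw (f h) (fun k => f (E k)) t.
Proof.
rewrite /pbw !rmorphM !rmorphXn rmorph_prod; congr (_ * _ * _).
by apply: eq_bigr => j _; rewrite rmorphXn.
Qed.

(** * Gelfand-Kirillov dimension from a PBW basis *)

Section PBWGrowth.
Variables (R : realType) (K : fieldType) (A : algType K) (m n : nat).
Variables (h : A) (E : nat -> A).
Hypothesis n_gt0 : (0 < n)%N.
Hypothesis EC : forall s t, E s * E t = E t * E s.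
Hypothesis Eh : forall s, E s * h = h * E s + E s.+1.
Hypothesis E_top : E m.+1 = 0.
Hypothesis E0n : E 0 ^+ n = 1.
Hypothesis exhaustive : forall x, exists d, filt h E d x.

Lemma pbw_span x : exists s c, x = \sum_(t <- s) c t *: @pbw K A m n h E t.
Proof.
have [d Fx] := exhaustive x.
have [c xc] := filt_box n_gt0 EC Eh E_top E0n Fx.
by exists (box m n d), c.
Qed.

Hypothesis pbw_basis : is_basis (@pbw K A m n h E).

Lemma filt_prods s d i x : (forall y, y \in s -> filt h E d y) ->
  x \in prods s i -> filt h E (d * i) x.
Proof.
move=> sd; elim: i x => [|i IH] x /=.
  rewrite inE => /eqP ->.
  have -> : 1 = h ^+ 0 * Eprod E [::] by rewrite /Eprod big_nil mulr1.
  exact: filt_mono.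
case/allpairsP => -[a b] /= [as_ bs ->]; rewrite mulnS.
by apply: filtM => //; [apply: sd | apply: IH].
Qed.

Lemma mem_prods (s l : seq A) : {subset l <= s} ->
  \prod_(x <- l) x \in prods s (size l).
Proof.
elim: l => [|a l IH] ls /=; first by rewrite big_nil inE.
rewrite big_cons; apply/allpairsP; exists (a, \prod_(x <- l) x); split => //=.
  by apply: ls; rewrite mem_head.
by apply: IH => x xl; apply: ls; rewrite inE xl orbT.
Qed.

Lemma mem_prods_upto (s : seq A) i M x :
  (i <= M)%N -> x \in prods s i -> x \in prods_upto s M.
Proof.
move=> iM xi; apply/flatten_mapP; exists i => //.
by rewrite mem_iota add0n ltnS.
Qed.

(** All the powers of [E_0] are generators, so that a PBW monomial uses one
generator for its bounded exponent whatever [n] is. *)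
Definition pbw_gens : seq A :=
  h :: [seq E j.+1 | j : 'I_m] ++ [seq E 0 ^+ b | b : 'I_n].

Lemma pbw_mem_prods d t : t \in box m n d ->
  exists2 i, (i <= m.+1 * d + 1)%N & pbw h E t \in prods pbw_gens i.
Proof.
move=> /mapP[[[i f] b] _ ->] /=.
pose l := nseq i h ++ flatten [seq nseq (f j) (E j.+1) | j <- rev (enum 'I_m)]
    ++ [:: E 0 ^+ b].
exists (size l).
  rewrite !size_cat size_nseq size_flatten /shape -map_comp map_rev sumn_rev.
  rewrite sumnE big_map big_enum /= addnA leq_add2r mulSn leq_add //.
    by rewrite -ltnS.
  under eq_bigr do rewrite size_nseq.
  apply: (@leq_trans (\sum_(j < m) d)).
    by apply: leq_sum => j _; rewrite -ltnS.
  by rewrite sum_nat_const card_ord.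
have -> : pbw h E (i : nat, [ffun j => f j : nat], b) = \prod_(x <- l) x.
  rewrite /pbw /= !big_cat /= big_seq1 mulrA big_nseq -Monoid.iteropE.
  congr (_ * _ * _); rewrite big_flatten big_map; apply: eq_bigr => j _.
  by rewrite ffunE big_nseq -Monoid.iteropE.
apply: mem_prods => x; rewrite /l 2!mem_cat => /or3P[|/flatten_mapP[j _]|].
- by rewrite mem_nseq => /andP[_ /eqP ->]; rewrite mem_head.
- rewrite mem_nseq => /andP[_ /eqP ->].
  by rewrite inE mem_cat (map_f (fun j : 'I_m => E j.+1)) ?mem_enum ?orbT.
- rewrite inE => /eqP ->.
  by rewrite inE mem_cat (map_f (fun b : 'I_n => E 0 ^+ b)) ?mem_enum ?orbT.
Qed.

Lemma GKdim_pbw : GKdim A R = m.+1%:R%:E.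
Proof.
apply: GKdim_polynomial_growth => [s|].
  have [d sd] : exists d, forall y, y \in s -> filt h E d y.
    elim: s => [|x s [d sd]]; first by exists 0%N.
    have [e xe] := exhaustive x; exists (maxn d e) => y; rewrite inE.
    case/orP=> [/eqP ->|/sd yd]; first exact: filt_leq (leq_maxr _ _) xe.
    exact: filt_leq (leq_maxl _ _) yd.
  exists (n * d.+1 ^ m.+1)%N; first by rewrite muln_gt0 n_gt0 expn_gt0.
  move=> M M0; apply: (@leq_trans (size (box m n (d * M)))).
    apply: (@span_dim_le _ _ _ (pbw h E)) => x /flatten_mapP[i].
    rewrite mem_iota ltnS => /andP[_ iM] /(filt_prods sd) Fx.
    apply: (filt_box n_gt0 EC Eh E_top E0n); apply: filt_leq Fx.
    by rewrite leq_mul2l iM orbT.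
  rewrite size_box mulnC -mulnA leq_mul2l -expnMn leq_exp2r // mulSn -addn1.
  by rewrite addnC leq_add2r M0 orbT.
exists pbw_gens, (m.+1 ^ m.+1)%N; split; first by rewrite expn_gt0.
(* The largest [d] such that the monomials of [box d], of length at most
   [(m + 1) d + 1], are products of at most [M] generators. *)
move=> M M0; set d := (M.-1 %/ m.+1)%N.
have dM : (m.+1 * d + 1 <= M)%N.
  by rewrite addn1 -(prednK M0) ltnS mulnC leq_trunc_div.
have Md : (M <= m.+1 * d.+1)%N.
  by rewrite -(prednK M0) mulnC ltn_ceil.
have := span_dim_ge pbw_basis (s := prods_upto pbw_gens M) (box_uniq m n d).
rewrite size_box => le.
apply: (@leq_trans (m.+1 ^ m.+1 * d.+1 ^ m.+1)).
  by rewrite -expnMn leq_exp2r.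
rewrite leq_mul2l; apply/orP; right.
apply: (@leq_trans (d.+1 ^ m.+1 * n)); first by rewrite leq_pmulr.
apply: le => t /pbw_mem_prods[i id]; apply: mem_prods_upto.
exact: leq_trans dM.
Qed.

End PBWGrowth.

(** * Brackets of pairs of words [g h^k] *)

Section LyndonWords.

(** Any letter [g] would start a smaller rotation, and a constant word of
length at least [2] equals its rotations. *)
Lemma lyndon_head_h (w : word) : lyndon (lh :: w) -> w = [::].
Proof.
case: w => // x w /lyndonP[_ L].
have: all (pred1 lh) (x :: w).
  apply/allP=> y; case: y => // yw; case/splitPr: yw L => a b L.
  have ha : lh :: a <> [::] by [].
  have gb : lg :: b <> [::] by [].
  by have := L _ _ ha gb erefl.
move=> /all_pred1P wE; have h1 : [:: lh] <> [::] by [].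
have xw : x :: w <> [::] by [].
have := L _ _ h1 xw erefl; rewrite wE.
rewrite -[lh :: nseq _ _]/(nseq (size (x :: w)).+1 lh) -addn1 nseqD.
by rewrite ltxx.
Qed.

Lemma lyndon_one_g (w : word) :
  lyndon w -> count_mem lg w = 1%N -> w = omega (size w).-1.
Proof.
case: w => [|[] w] // Lw; first by rewrite (lyndon_head_h Lw).
rewrite /= add1n => -[/eqP]; rewrite -leqn0 leqNgt -has_count => w0.
rewrite /omega; congr (_ :: _); apply/all_pred1P; move: w0.
by rewrite -all_predC; apply: sub_all => -[].
Qed.

Lemma cat_omega_inj (a b : word) s t :
  a ++ omega s = b ++ omega t -> s = t.
Proof.
move/(congr1 rev); rewrite !rev_cat !rev_cons -!cats1 -!catA /=.
have rn k : rev (nseq k lh) = nseq k lh.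
  rewrite -[in RHS](size_nseq k lh) -size_rev; apply/all_pred1P.
  by rewrite all_rev all_pred1_nseq.
rewrite !rn; by elim: s t => [|s IH] [|t] //= [/IH ->].
Qed.

(** Since [u] starts with the first of the two letters [g], the letter displayed
after [u] is the second one. *)
Lemma omega_pair_suffix s t (u v : word) :
  omega s ++ omega t = u ++ lg :: v -> u <> [::] -> v = nseq t lh.
Proof.
case: u => // x u uv _.
have xE : x = lg by case: uv.
move: uv; rewrite xE => uv.
have: count_mem lg ((lg :: u) ++ lg :: v) = 2.
  by rewrite -uv count_cat /= !count_nseq.
rewrite count_cat /= addnCA !add1n => -[/eqP]; rewrite addn_eq0 => /andP[_ v0].
have vE : v = nseq (size v) lh.
  apply/all_pred1P; move: v0.
  by rewrite -leqn0 leqNgt -has_count -all_predC; apply: sub_all => -[].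
by rewrite vE in uv; rewrite (cat_omega_inj uv) -vE.
Qed.

(** Rotations starting with [h] are larger.  The only other one is
[omega t ++ omega s], and [g h^s g] is smaller than [g h^t] since [s < t]. *)
Lemma lyndon_omega_pair s t : (s < t)%N -> lyndon (omega s ++ omega t).
Proof.
move=> st; apply/lyndonP; split=> // u v u0 v0.
case: v v0 => // -[] v _ uv; first by [].
rewrite (omega_pair_suffix uv u0) /omega /=.
rewrite ltxi_cons lexx /=.
move: {1}(nseq t lh) => r; elim: s t st {uv} => [|s IH] [|t] //= st.
by rewrite ltxi_cons lexx /= IH.
Qed.

(** A Lyndon suffix which starts with [h] is the letter [h], and a proper one
which starts with [g] is [omega t]; neither is longer than [omega t]. *)
Lemma omega_pair_std_fact s t : (s < t)%N ->
  is_std_fact (omega s ++ omega t) (omega s) (omega t).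
Proof.
move=> st; split; rewrite ?lyndon_omega //.
move=> u [|[] v] E // Lu Lv; first by rewrite (lyndon_head_h Lv).
have u0 : u <> [::] by case: u Lu {E}.
by rewrite (omega_pair_suffix E u0).
Qed.

Lemma bracket_omega_pair (K : fieldType) s t : (s < t)%N ->
  bracket K (omega s ++ omega t) =
  commutator (bracket K (omega s)) (bracket K (omega t)).
Proof. by move=> st; apply/bracketE/omega_pair_std_fact. Qed.
End LyndonWords.

(** * The differential operator model *)

Section Model.
Variables (K : fieldType) (m : nat).
Local Notation P := {mpoly K[m.+2]}.

(** The variables with index at most [m] are [x_0, ..., x_m]; the convention
[x_s = 0] for [s > m] makes the formulas for the derivation uniform in [s].
The last variable is [y]. *)
Definition xvar (k : nat) : P := if (k <= m)%N then 'X_(inord k) else 0.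
Definition yvar : P := 'X_ord_max.

(** The derivation such that [D x_s = x_(s+1)] and [D y = 0]. *)
Definition shift_deriv (f : P) : P :=
  \sum_(i < m.+1) xvar i.+1 * f^`M(inord i).

Lemma shift_derivD f g : shift_deriv (f + g) = shift_deriv f + shift_deriv g.
Proof.
rewrite /shift_deriv -big_split; apply: eq_bigr => i _ /=.
by rewrite mderivD mulrDr.
Qed.

Lemma shift_derivM f g :
  shift_deriv (f * g) = shift_deriv f * g + f * shift_deriv g.
Proof.
rewrite /shift_deriv mulr_suml mulr_sumr -big_split; apply: eq_bigr => i _ /=.
by rewrite mderivM; ring.
Qed.

Lemma shift_derivC c : shift_deriv c%:MP = 0.
Proof. by rewrite /shift_deriv big1 // => i _; rewrite mderivC mulr0. Qed.

Lemma shift_deriv0 : shift_deriv 0 = 0.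
Proof. by rewrite -[0 in LHS](mpolyC0 m.+2) shift_derivC. Qed.

Lemma mderiv_var (i j : 'I_m.+2) : ('X_j : P)^`M(i) = (i == j)%:R.
Proof.
rewrite mderivX mnm1E eq_sym; case: eqP => [->|_]; last by rewrite scale0r.
have -> : (U_(j) - U_(j) = 0)%MM by apply/mnmP => k; rewrite !mnmE subnn.
by rewrite mpolyX0 scale1r.
Qed.

Lemma inord_eq (i k : nat) : (i <= m.+1)%N -> (k <= m.+1)%N ->
  (inord i == inord k :> 'I_m.+2) = (i == k).
Proof. by move=> im km; rewrite -val_eqE /= !inordK. Qed.

Lemma shift_deriv_xvar k : shift_deriv (xvar k) = xvar k.+1.
Proof.
rewrite {1}/xvar; have [km|mk] := leqP k m; last first.
  by rewrite shift_deriv0 /xvar ltnNge (ltnW mk).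
rewrite /shift_deriv (bigD1 (Ordinal (km : (k < m.+1)%N))) //=.
rewrite mderiv_var eqxx mulr1 big1 ?addr0 // => i; rewrite -val_eqE /= => ik.
rewrite mderiv_var inord_eq ?(negPf ik) ?mulr0 //.
  by rewrite ltnW // ltnS ltnW.
by rewrite ltnW.
Qed.

Lemma shift_deriv_yvar : shift_deriv yvar = 0.
Proof.
rewrite /shift_deriv big1 // => i _; rewrite mderiv_var.
have -> : (inord i == ord_max :> 'I_m.+2) = false; last by rewrite mulr0.
rewrite -val_eqE /= inordK; last by rewrite ltnW // ltnS.
by rewrite ltn_eqF.
Qed.

Lemma shift_derivX f k : shift_deriv (f ^+ k) = shift_deriv f * f ^+ k.-1 *+ k.
Proof.
elim: k => [|k IH]; first by rewrite expr0 -(mpolyC1 m.+2 K) shift_derivC.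
rewrite exprS shift_derivM IH mulrS; congr (_ + _).
by case: k {IH} => [|k] /=; rewrite ?mulr0n ?mulr0 // mulrnAr mulrCA exprS.
Qed.

(** A right action, in order that [h^i E g^j] sends [1] to a monomial: the
powers of [h] act first, on [1], where [D] vanishes. *)
Definition act_letter (v : P) (x : letter) : P :=
  if x then yvar * v + shift_deriv v else xvar 0 * v.

Definition act (v : P) (f : free_alg K) : P :=
  monalg.mmap (@mpolyC m.+2 K)
    (fun w : {fmonom bool} => foldl act_letter v w) f.

Lemma act_letterD v w x :
  act_letter (v + w) x = act_letter v x + act_letter w x.
Proof. by case: x; rewrite /act_letter ?shift_derivD !mulrDr // addrACA. Qed.

Lemma act_letterM c v x : shift_deriv c = 0 ->
  act_letter (c * v) x = c * act_letter v x.
Proof.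
move=> c0; case: x; rewrite /act_letter ?shift_derivM ?c0 ?mul0r ?add0r.
  by rewrite mulrDr mulrCA.
by rewrite mulrCA.
Qed.

Lemma act0 v : act v 0 = 0. Proof. exact: raddf0. Qed.
Lemma actD v f g : act v (f + g) = act v f + act v g.
Proof. exact: raddfD. Qed.
Lemma actB v f g : act v (f - g) = act v f - act v g.
Proof. exact: raddfB. Qed.
Lemma act_sum v I (s : seq I) (F : I -> free_alg K) :
  act v (\sum_(i <- s) F i) = \sum_(i <- s) act v (F i).
Proof. exact: raddf_sum. Qed.

Lemma actU v c w : act v << c *g w >> = c%:MP * foldl act_letter v w.
Proof. by rewrite /act monalg.mmapU. Qed.

Lemma foldl_act_letterD w v1 v2 : foldl act_letter (v1 + v2) w =
  foldl act_letter v1 w + foldl act_letter v2 w.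
Proof. by elim: w v1 v2 => //= x w IH v1 v2; rewrite act_letterD IH. Qed.

Lemma foldl_act_letterM c w v : shift_deriv c = 0 ->
  foldl act_letter (c * v) w = c * foldl act_letter v w.
Proof. by move=> c0; elim: w v => //= x w IH v; rewrite act_letterM. Qed.

Lemma act_addl v1 v2 f : act (v1 + v2) f = act v1 f + act v2 f.
Proof.
rewrite /act !monalg.mmapE -big_split; apply: eq_bigr => w _ /=.
by rewrite foldl_act_letterD mulrDr.
Qed.

(** Constants of the derivation commute with the whole action.  This gives both
linearity over [K] and, when [n] is zero in [K], stability of the multiples of
[x_0^n - 1]. *)
Lemma act_mull c v f : shift_deriv c = 0 -> act (c * v) f = c * act v f.
Proof.
move=> c0; rewrite /act !monalg.mmapE mulr_sumr; apply: eq_bigr => w _ /=.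
by rewrite foldl_act_letterM // mulrCA.
Qed.

Lemma act_zero f : act 0 f = 0.
Proof. by rewrite -(mul0r 0) act_mull ?mul0r // shift_deriv0. Qed.

Lemma act_suml I (s : seq I) (F : I -> P) f :
  act (\sum_(i <- s) F i) f = \sum_(i <- s) act (F i) f.
Proof.
elim: s => [|i s IH]; first by rewrite !big_nil act_zero.
by rewrite !big_cons act_addl IH.
Qed.

Lemma actM v f g : act v (f * g) = act (act v f) g.
Proof.
have -> : f * g = \sum_(k1 <- finmap.enum_fset (monalg.msupp f))
  \sum_(k2 <- finmap.enum_fset (monalg.msupp g))
    << monalg.mcoeff k1 f * monalg.mcoeff k2 g *g mmul k1 k2 >> :> free_alg K.
  exact: malgME.
rewrite act_sum [act v f in RHS]monalg.mmapE act_suml.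
apply: eq_bigr => w _; rewrite act_sum act_mull ?shift_derivC //.
rewrite [act _ g]monalg.mmapE mulr_sumr; apply: eq_bigr => w' _.
by rewrite actU mpolyCM -mulrA -foldl_cat /mmul /= /fmmul fmE.
Qed.

Lemma act_gen v x : act v (gen K x) = act_letter v x.
Proof. by rewrite actU mpolyC1 mul1r /fmu fmE. Qed.

Lemma act_one v : act v 1 = v.
Proof. by rewrite actU mpolyC1 mul1r /mone /= /fmone fmE. Qed.

Lemma actZ v c f : act v (c *: f) = c *: act v f.
Proof.
have -> : c *: f = << c *g mone >> * f :> free_alg K.
  exact/esym/mul_malgC.
rewrite actM actU /mone /= /fmone fmE /= act_mull ?shift_derivC //.
by rewrite mul_mpolyC.
Qed.

Lemma act_commutator v f g :
  act v (commutator f g) = act (act v f) g - act (act v g) f.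
Proof. by rewrite actB; congr (_ - _); apply: actM. Qed.

(** If [E] acts as multiplication by [x], then [E h - h E] acts as
[v |-> (y + D) (x v) - x (y + D) v = (D x) v]. *)
Lemma act_bracket_omega k v : act v (bracket K (omega k)) = xvar k * v.
Proof.
elim: k v => [|k IH] v; first by rewrite bracket1 act_gen.
rewrite bracket_omegaS act_commutator !IH bracket1 !act_gen /=.
by rewrite shift_derivM shift_deriv_xvar; ring.
Qed.
End Model.

(** * Relations act as zero modulo [x_0^n - 1] *)

Section Ideals.
Variables (K : fieldType).

(** Two-sided ideals; closure under scaling follows from multiplication by
[c *: 1]. *)
Definition is_ideal (A : algType K) (J : A -> Prop) : Prop :=
  [/\ J 0, forall x y, J x -> J y -> J (x + y),
      forall a x, J x -> J (a * x) & forall a x, J x -> J (x * a)].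

Lemma ideal_gen_min (A : algType K) (S J : A -> Prop) :
  is_ideal J -> (forall x, S x -> J x) -> forall x, ideal_gen S x -> J x.
Proof. by case=> J0 JD Jl Jr SJ x; elim=> //; auto. Qed.

Variables (A : algType K) (S : A -> Prop) (S_proper : ~ ideal_gen S 1).

Definition ideal_image (J : A -> Prop) (u : quot_alg S_proper) : Prop :=
  exists2 x, proj S_proper x = u & J x.

Lemma ideal_image_ideal J : is_ideal J -> is_ideal (ideal_image J).
Proof.
case=> J0 JD Jl Jr; split.
- by exists 0; rewrite ?proj0.
- move=> _ _ [x <- Jx] [y <- Jy].
  by exists (x + y); rewrite ?projD //; apply: JD.
- move=> a _ [x <- Jx]; have [b <-] := proj_surj a.
  by exists (b * x); rewrite ?projM //; apply: Jl.
- move=> a _ [x <- Jx]; have [b <-] := proj_surj a.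
  by exists (x * b); rewrite ?projM //; apply: Jr.
Qed.

Lemma ideal_imageK J x : is_ideal J -> (forall y, S y -> J y) ->
  ideal_image J (proj S_proper x) -> J x.
Proof.
move=> JI SJ [y /esym/projP xy Jy]; have [_ JD _ _] := JI.
by rewrite -(subrK y x); apply: JD => //; apply: ideal_gen_min xy.
Qed.

End Ideals.

(** The quotient is taken in three steps; at each step, the image of [J] is
an ideal which contains the new relations, and its preimage is again [J]. *)
Lemma to_Tbarn'_eq0 (K : fieldType) n p (p_prime : prime p)
    (J : free_alg K -> Prop) :
  is_ideal J -> (forall x, Tbar_rel x -> J x) -> J (gen K lg ^+ n - 1) ->
  J (bracket K (omega p.-1)) -> forall x, to_Tbarn' n p_prime x = 0 -> J x.
Proof.
move=> JI JT Jg JE x.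
pose J1 : Tbar K -> Prop := ideal_image (S_proper := @Tbar_proper K) J.
have J1I : is_ideal J1 by exact: ideal_image_ideal.
have J1g y : Tbarn_rel n y -> J1 y.
  move=> ->; exists (gen K lg ^+ n - 1) => //.
  rewrite projD projN; congr (_ - _).
  elim: (n) => [|k IH]; first by rewrite !expr0.
  by rewrite !exprS projM IH.
pose J2 : Tbarn K n -> Prop := ideal_image (S_proper := @Tbarn_proper K n) J1.
have J2I : is_ideal J2 by exact: ideal_image_ideal.
rewrite /to_Tbarn' -(proj0 (@Tbarn'_proper K n p p_prime)) => /projP.
rewrite subr0 => Hx.
apply: (ideal_imageK (S_proper := @Tbar_proper K) JI JT).
apply: (ideal_imageK (S_proper := @Tbarn_proper K n) J1I J1g).
apply: ideal_gen_min Hx => // y ->.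
exists (to_Tbar (bracket K (omega p.-1))) => //.
by exists (bracket K (omega p.-1)).
Qed.

(** The word need not be Lyndon: without a factorization into Lyndon words the
split position is the length of [w], and both sides vanish. *)
Lemma bracket_std_split (K : fieldType) (w : word) : (1 < size w)%N ->
  bracket K w = commutator (bracket K (take (std_split w) w))
                           (bracket K (drop (std_split w) w)).
Proof.
move=> w1; have [k wk] : {k | size w = k.+1}.
  by exists (size w).-1; rewrite prednK // ltnW.
rewrite {1}/bracket wk (bracket_recS _ _ w1); set i := std_split w.
have [iw|wi] := ltnP i (size w); last first.
  by rewrite (drop_oversize wi) /bracket !bracket_rec_nil !commutator0.
have i0 := std_split_gt0 w1.
have kt : (size (take i w) <= k)%N by rewrite size_take iw -ltnS -wk.
have kd : (size (drop i w) <= k)%N.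
  by rewrite size_drop wk leq_subLR -addn1 addnC leq_add2r.
rewrite /bracket (bracket_rec_depth K kt (leqnn _)).
by rewrite (bracket_rec_depth K kd (leqnn _)).
Qed.

Section Annihilator.
Variables (K : fieldType) (m n : nat).
Local Notation P := {mpoly K[m.+2]}.

(** By induction on the length: if a standard factor has at least two [g]'s, it
acts as zero.  Otherwise both factors have exactly one [g], so they are of the
form [omega k] and act by multiplications, which commute. *)
Lemma act_bracket_two_g (w : word) (v : P) :
  lyndon w -> (2 <= count_mem lg w)%N -> act v (bracket K w) = 0.
Proof.
elim: {w}(size w) {-2}w (leqnn (size w)) v => [|k IH] w wk v.
  by case: w wk.
move=> Lw w2; have w1 : (1 < size w)%N := leq_trans w2 (count_size _ _).
rewrite bracket_std_split //; set i := std_split w.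
have [iw|wi] := ltnP i (size w); last first.
  by rewrite (drop_oversize wi) {2}/bracket /= commutator0 act0.
have i0 : (0 < i)%N := std_split_gt0 w1.
have hs : has (fun i => lyndon (take i w) && lyndon (drop i w))
              (iota 0 (size w)) by rewrite has_find size_iota.
have /andP[Lu Lv] := nth_find 0%N hs.
rewrite -/(std_split w) -/i nth_iota // add0n in Lu Lv.
have su : (size (take i w) <= k)%N by rewrite size_take iw -ltnS (leq_trans iw).
have sv : (size (drop i w) <= k)%N.
  by rewrite size_drop leq_subLR (leq_trans wk) // -add1n leq_add2r.
move: w2; rewrite -{1}(cat_take_drop i w) count_cat.
move: (take i w) (drop i w) Lu Lv su sv.
move=> {Lw w1 iw i0 hs wk i w} w1 w2 L1 L2 s1 s2 c.
rewrite act_commutator.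
have [c1|c1] := leqP 2 (count_mem lg w1).
  by rewrite !(IH w1) // act_zero subrr.
have [c2|c2] := leqP 2 (count_mem lg w2).
  by rewrite !(IH w2) // act_zero subrr.
have [e1 e2] : count_mem lg w1 = 1%N /\ count_mem lg w2 = 1%N.
  by move: c c1 c2; case: (count_mem lg w1) => [|[]] //;
    case: (count_mem lg w2) => [|[]].
rewrite (lyndon_one_g L1 e1) (lyndon_one_g L2 e2) !act_bracket_omega.
by rewrite mulrCA subrr.
Qed.

Local Notation gpow := (xvar K m 0 ^+ n - 1).

(** The annihilator of the quotient of the module by [x_0^n - 1]. *)
Definition quot_annihilator (f : free_alg K) : Prop :=
  forall v : P, exists q, act v f = gpow * q.

Lemma shift_deriv_gpow : (n%:R : K) = 0 -> shift_deriv gpow = 0.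
Proof.
move=> n0; rewrite shift_derivD -mpolyC1 -mpolyCN shift_derivC addr0.
by rewrite shift_derivX -mulr_natr -mpolyC_nat n0 mpolyC0 mulr0.
Qed.

Lemma quot_annihilator_ideal : (n%:R : K) = 0 -> is_ideal quot_annihilator.
Proof.
move=> n0; split.
- by move=> v; exists 0; rewrite act0 mulr0.
- move=> x y Jx Jy v; have [[a xa] [b yb]] := (Jx v, Jy v).
  by exists (a + b); rewrite actD xa yb mulrDr.
- by move=> a x Jx v; rewrite actM; apply: Jx.
- move=> a x Jx v; have [q xq] := Jx v.
  by exists (act q a); rewrite actM xq act_mull // shift_deriv_gpow.
Qed.

Lemma actX (v c : P) f k :
  (forall u, act u f = c * u) -> act v (f ^+ k) = c ^+ k * v.
Proof.
move=> fc; elim: k v => [|k IH] v; first by rewrite !expr0 act_one mul1r.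
by rewrite !exprS actM fc IH mulrA -exprSr exprS.
Qed.

Lemma to_Tbarn'_annihilator p (p_prime : prime p) :
  (n%:R : K) = 0 -> (m < p.-1)%N ->
  forall x, to_Tbarn' n p_prime x = 0 -> quot_annihilator x.
Proof.
move=> n0 mp; apply: to_Tbarn'_eq0; first exact: quot_annihilator_ideal.
- move=> _ [w /andP[Lw w2] ->] v; exists 0.
  by rewrite act_bracket_two_g // mulr0.
- move=> v; exists v; rewrite actB act_one mulrBl mul1r.
  by rewrite (actX (c := xvar K m 0) v) => [//|u]; rewrite act_gen.
- by move=> v; exists 0; rewrite act_bracket_omega /xvar leqNgt mp mul0r mulr0.
Qed.
End Annihilator.

(** * Independence of the monomials *)

Section Independence.
Variables (K : fieldType) (m n : nat).
Hypothesis n_gt0 : (0 < n)%N.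
Local Notation P := {mpoly K[m.+2]}.
Local Notation exponents := (nat * {ffun 'I_m -> nat} * 'I_n)%type.
Local Notation x0 := (xvar K m 0).
Implicit Types (t : exponents).

(** Variable [0] is [x_0], variable [j + 1] with [j < m] is [x_(j+1)], and for
the last variable [y] the index [k.-1 = m] is out of range, which selects the
default value [t.1.1]. *)
Definition pbw_mnm t : 'X_{1..m.+2} :=
  [multinom if k == 0%N :> nat then t.2 : nat else
     oapp t.1.2 t.1.1 (insub k.-1) | k < m.+2].

Lemma pbw_mnm0 t : pbw_mnm t ord0 = t.2.
Proof. by rewrite mnmE. Qed.

Lemma pbw_mnm_mid t (j : 'I_m) (k : 'I_m.+2) : k = j.+1 :> nat ->
  pbw_mnm t k = t.1.2 j.
Proof. by move=> kj; rewrite mnmE kj /= valK. Qed.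

Lemma pbw_mnm_max t (k : 'I_m.+2) : k = m.+1 :> nat -> pbw_mnm t k = t.1.1.
Proof. by move=> km; rewrite mnmE km /= insubF ?ltnn. Qed.

Lemma pbw_mnm_inj : injective pbw_mnm.
Proof.
move=> [[i f] b] [[i' f'] b'] tt'.
have ii' : i = i'.
  have := congr1 (fun u : 'X_{1..m.+2} => u ord_max) tt'.
  by rewrite !pbw_mnm_max.
have bb' : b = b'.
  apply: val_inj; have := congr1 (fun u : 'X_{1..m.+2} => u ord0) tt'.
  by rewrite !pbw_mnm0.
rewrite ii' bb'; suff -> : f = f' by []; apply/ffunP => j.
have jk : (inord j.+1 : 'I_m.+2) = j.+1 :> nat.
  by rewrite inordK // !ltnS ltnW.
have := congr1 (fun u : 'X_{1..m.+2} => u (inord j.+1)) tt'.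
by rewrite !(pbw_mnm_mid _ jk).
Qed.

Definition pbw_poly t : P := @pbw _ _ m n (yvar K m) (xvar K m) t.

Lemma pbw_polyE t : pbw_poly t = 'X_[pbw_mnm t].
Proof.
rewrite mpolyXE_id big_ord_recl big_ord_recr /= pbw_mnm0.
rewrite (pbw_mnm_max _ (k := lift ord0 ord_max)) //.
have -> : 'X_(lift ord0 ord_max) = yvar K m by congr 'X__; apply: val_inj.
have -> : 'X_ord0 = x0.
  by rewrite /xvar; congr 'X__; apply: val_inj; rewrite /= inordK.
suff xE : \prod_(j <- rev (enum 'I_m)) xvar K m j.+1 ^+ t.1.2 j =
    \prod_(j < m) 'X_(lift ord0 (widen_ord (leqnSn m) j))
      ^+ pbw_mnm t (lift ord0 (widen_ord (leqnSn m) j)).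
  rewrite /pbw_poly /pbw xE [RHS]mulrC -mulrA.
  by rewrite [_ * yvar K m ^+ _]mulrC -mulrA.
rewrite (perm_big (enum 'I_m)) /=; last by rewrite perm_rev.
rewrite big_enum; apply: eq_bigr => j _ /=.
rewrite (pbw_mnm_mid _ (j := j)) // /xvar ltn_ord.
by congr (_ ^+ _); congr 'X__; apply: val_inj; rewrite /= inordK // !ltnS ltnW.
Qed.

(** Views a polynomial as a polynomial in [x_0] alone, in order to use degrees
in [x_0]; the coefficients keep all the variables, so that evaluation at [x_0]
is a left inverse. *)
Definition peel_x0 : P -> {poly P} :=
  mmap ((@polyC P) \o (@mpolyC m.+2 K))
    (fun k => if k == 0%N :> nat then 'X else ('X_k)%:P).

HB.instance Definition _ := GRing.RMorphism.on peel_x0.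

Lemma peel_X (k : 'I_m.+2) :
  peel_x0 'X_k = if k == 0%N :> nat then 'X else ('X_k)%:P.
Proof. by rewrite /peel_x0 mmapX mmap1U. Qed.

Lemma peel_pbw_poly t : peel_x0 (pbw_poly t) =
  (yvar K m ^+ t.1.1 * \prod_(j <- rev (enum 'I_m)) xvar K m j.+1 ^+ t.1.2 j)
    *: 'X^(t.2).
Proof.
rewrite /pbw_poly /pbw -mul_polyC !rmorphM !rmorphXn /= !rmorph_prod /=.
rewrite peel_X /= /xvar peel_X /= inordK //=; congr (_ * _ * _).
apply: eq_bigr => j _; rewrite !rmorphXn /= ltn_ord peel_X.
by rewrite (inordK (n' := m.+1)) // !ltnS ltnW.
Qed.

Lemma peelZ c f : peel_x0 (c *: f) = (c%:MP)%:P * peel_x0 f.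
Proof. exact: mmapZ. Qed.

Lemma act_yX k (v : P) : shift_deriv v = 0 ->
  act v (gen K lh ^+ k) = yvar K m ^+ k * v.
Proof.
elim: k v => [|k IH] v v0; first by rewrite !expr0 act_one mul1r.
rewrite exprS actM act_gen /= v0 addr0 IH ?mulrA -?exprSr //.
by rewrite shift_derivM v0 shift_deriv_yvar mul0r mulr0 addr0.
Qed.

Lemma act_Eprod (a : 'I_m -> nat) (r : seq 'I_m) (v : P) :
  act v (\prod_(j <- r) bracket K (omega j.+1) ^+ a j) =
  v * \prod_(j <- r) xvar K m j.+1 ^+ a j.
Proof.
elim: r v => [|j r IH] v; first by rewrite !big_nil act_one mulr1.
rewrite !big_cons actM IH (actX (c := xvar K m j.+1) _) => [|u].
  by rewrite [RHS]mulrCA mulrA.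
exact: act_bracket_omega.
Qed.

Lemma act_pbw t : act 1 (pbw (gen K lh) (fun k => bracket K (omega k)) t)
  = pbw_poly t.
Proof.
rewrite /pbw actM (actX (c := x0) _) => [|u]; last exact: act_bracket_omega.
rewrite actM act_Eprod act_yX ?mulr1; first exact: mulrC.
by rewrite -mpolyC1 shift_derivC.
Qed.

(** As a polynomial in [x_0] the left-hand side has degree less than [n], while
a nonzero multiple of the monic polynomial [x_0^n - 1] has degree at least
[n].  So the combination vanishes, and distinct exponents give distinct
monomials. *)
Lemma pbw_poly_indep (s : seq exponents) (c : exponents -> K) q : uniq s ->
  \sum_(t <- s) c t *: pbw_poly t = (x0 ^+ n - 1) * q ->
  forall t, t \in s -> c t = 0.
Proof.
move=> us sq; set F := (X in X = _) in sq.
have peelF : peel_x0 F = \sum_(t <- s) (c t)%:MP%:P * peel_x0 (pbw_poly t).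
  by rewrite rmorph_sum; apply: eq_bigr => t _; apply: peelZ.
have F0 : F = 0.
  have -> : F = (peel_x0 F).[x0].
    rewrite peelF horner_sum; apply: eq_bigr => t _.
    by rewrite peel_pbw_poly hornerM hornerC hornerZ hornerXn mul_mpolyC.
  suff -> : peel_x0 F = 0 by rewrite horner0.
  have szF : (size (peel_x0 F) <= n)%N.
    rewrite peelF (leq_trans (size_sum _ _ _)) //.
    apply/bigmax_leqP_seq => t _ _.
    rewrite peel_pbw_poly mul_polyC !(leq_trans (size_scale_leq _ _)) //.
    by rewrite size_polyXn.
  have : peel_x0 F = peel_x0 q * ('X^n - 1%:P).
    rewrite sq rmorphM rmorphB rmorph1 rmorphXn /= {1}/xvar peel_X /=.
    rewrite inordK //=.
    exact: mulrC.
  have [->|q0] := eqVneq (peel_x0 q) 0; first by rewrite mul0r.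
  move=> pF; move: szF; rewrite pF size_Mmonic ?monicXnsubC // size_XnsubC //.
  by rewrite addnS /= leqNgt -{1}[n]add0n ltn_add2r lt0n size_poly_eq0 q0.
move=> t ts; have := congr1 (mcoeff (pbw_mnm t)) F0.
rewrite mcoeff0 raddf_sum /= (bigD1_seq t) //= big1 ?addr0 => [|t' t't].
  by rewrite mcoeffZ pbw_polyE mcoeffX eqxx mulr1.
rewrite mcoeffZ pbw_polyE mcoeffX (inj_eq pbw_mnm_inj) (negPf t't).
by rewrite mulr0.
Qed.

End Independence.

(** * Relations in the quotient algebra *)

Section Presentation.
Variables (K : fieldType) (n p : nat) (p_prime : prime p).
Local Notation pi := (@to_Tbarn' K n p p_prime).

Lemma to_Tbarn'_zmod : zmod_morphism pi.
Proof.
by move=> x y; rewrite /to_Tbarn' /to_Tbarn /to_Tbar !projD !projN.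
Qed.
HB.instance Definition _ := GRing.isZmodMorphism.Build _ _ pi to_Tbarn'_zmod.

Lemma to_Tbarn'_monoid : monoid_morphism pi.
Proof.
split=> [|x y]; first by rewrite /to_Tbarn' /to_Tbarn /to_Tbar !proj1.
by rewrite /to_Tbarn' /to_Tbarn /to_Tbar !projM.
Qed.
HB.instance Definition _ :=
  GRing.isMonoidMorphism.Build _ _ pi to_Tbarn'_monoid.

Lemma to_Tbarn'Z c x : pi (c *: x) = c *: pi x.
Proof. by rewrite /to_Tbarn' /to_Tbarn /to_Tbar !projZ. Qed.

Lemma to_Tbarn'_surj a : exists x, pi x = a.
Proof.
have [b <-] := proj_surj a; have [c <-] := proj_surj b.
by have [x <-] := proj_surj c; exists x.
Qed.

Local Notation E k := (pi (bracket K (omega k))).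
Local Notation h := (pi (gen K lh)).

Lemma E_h s : E s * h = h * E s + E s.+1.
Proof.
by rewrite bracket_omegaS bracket1 rmorphB 2!rmorphM [RHS]addrC subrK.
Qed.

(** For [s < t], the difference is the bracket of the Lyndon word
[omega s ++ omega t], which has two letters [g]. *)
Lemma E_comm s t : E s * E t = E t * E s.
Proof.
wlog st : s t / (s < t)%N.
  move=> W; have [st|ts|->//] := ltngtP s t; first exact: W.
  exact/esym/W.
apply/eqP; rewrite -subr_eq0 -!rmorphM -rmorphB /= -/(commutator _ _).
rewrite -bracket_omega_pair //; apply/eqP.
have -> : to_Tbarn' n p_prime (bracket K (omega s ++ omega t)) = pi 0.
  rewrite /to_Tbarn' /to_Tbarn; congr (proj _ (proj _ _)).
  apply/projP; rewrite subr0; apply: ideal_mem.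
  exists (omega s ++ omega t) => //.
  by rewrite lyndon_omega_pair // count_cat /= !add1n addnS.
exact: rmorph0.
Qed.

Lemma E_top : E p.-1 = 0.
Proof.
rewrite -(rmorph0 pi); apply/projP.
by rewrite /to_Tbarn {2}/to_Tbar !proj0 subr0; apply: ideal_mem.
Qed.

Lemma E0_exp : E 0%N ^+ n = 1.
Proof.
rewrite -rmorphXn -(rmorph1 pi) /= bracket1; congr (proj _ _).
apply/projP; apply: ideal_mem; rewrite /Tbarn_rel; congr (_ - _).
by elim: (n) => [|k IH]; rewrite ?expr0 // !exprS /to_Tbar projM -IH.
Qed.

(** Each word in the generators lies in the layer of its length, by right
multiplication by one letter at a time; an element is a combination of
finitely many words. *)
Lemma filt_exhaustive a : exists d, filt h (fun k => E k) d a.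
Proof.
have [f <-] := to_Tbarn'_surj a.
have word_filt (w : seq bool) :
    exists d, filt h (fun k => E k) d (pi (\prod_(x <- w) gen K x)).
  elim/last_ind: w => [|w x [d IH]].
    exists 0%N; rewrite big_nil rmorph1.
    have -> : 1 = h ^+ 0 * Eprod (fun k => E k) [::].
      by rewrite /Eprod big_nil mulr1.
    exact: filt_mono.
  exists d.+1; rewrite big_rcons /= rmorphM /=.
  case: x; first exact: (filt_mulh E_h IH).
  exact: (filt_mulE E_comm 0 IH).
have wordE (w : {fmonom bool}) : << w >> = \prod_(x <- w) gen K x :> free_alg K.
  case: w => w; elim: w => [|x w IH]; first by rewrite big_nil /= -fmE.
  rewrite big_cons -IH; apply/esym; apply: etrans (fgmulUU _ _ _ _) _.
  by rewrite mulr1 /= /mmul /= /fmmul /fmu !fmE.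
rewrite [f]monalgE; elim: (finmap.enum_fset _) => [|w r [d IH]].
  by exists 0%N; rewrite big_nil rmorph0; apply: filt0.
rewrite big_cons rmorphD /=; have [e we] := word_filt w.
exists (maxn d e); apply: filtD; last exact: filt_leq (leq_maxl _ _) IH.
have -> : << monalg.mcoeff w f *g w >> =
    monalg.mcoeff w f *: << w >> :> free_alg K.
  apply: etrans (mul_malgC _ _); apply/esym.
  by apply: etrans (fgmulUU _ _ _ _) _; rewrite mulr1 mul1m.
rewrite to_Tbarn'Z wordE; apply: filtZ; exact: filt_leq (leq_maxr _ _) we.
Qed.

End Presentation.

(** * The PBW basis and the dimension *)

Theorem lemma3p6 (R : realType) (K : fieldType) (p n : nat)
    (charK : p \in [pchar K]) (n_ge2 : (2 <= n)%N) (p_dvd_n : (p %| n)%N)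
    (Egh_neq0 : to_Tbarn n (bracket K [:: lg; lh]) <> 0) :
  let p_prime := pcharf_prime charK in
  let A := Tbarn' K n p_prime in
  let g : A := to_Tbarn' n p_prime (gen K lg) in
  let h : A := to_Tbarn' n p_prime (gen K lh) in
  let E (k : nat) : A := to_Tbarn' n p_prime (bracket K (omega k)) in
  [/\ GKdim A R = (p.-1)%:R%:E,
      (* [j : 'I_(p - 2)] stands for [k = j + 1], with [1 <= k <= p - 2];
         the product is over decreasing [k]. *)
      is_basis (fun t : nat * {ffun 'I_(p - 2) -> nat} * 'I_n =>
        h ^+ t.1.1 *
        (\prod_(j <- rev (enum 'I_(p - 2))) E j.+1 ^+ t.1.2 j) *
        g ^+ t.2)
    & [/\ g ^+ n = 1,
          forall s : nat, (s < p - 2)%N -> E s * h = h * E s + E s.+1,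
          E (p - 2)%N * h = h * E (p - 2)%N
        & forall s t : nat, (s < t <= p - 2)%N -> E s * E t = E t * E s]].
Proof.
move=> p_prime A g h E.
have n_gt0 : (0 < n)%N := ltnW n_ge2.
have pE : p.-1 = (p - 2).+1 by rewrite -subSn ?prime_gt1 // subSS subn1.
have n0 : n%:R = 0 :> K.
  by have /dvdnP[k ->] := p_dvd_n; rewrite natrM (pcharf0 charK) mulr0.
have Eh s : E s * h = h * E s + E s.+1 by apply: E_h.
have EC s t : E s * E t = E t * E s by apply: E_comm.
have E0n : E 0%N ^+ n = 1 by apply: E0_exp.
have Etop : E (p - 2).+1 = 0 by rewrite -pE; apply: E_top.
have exh (a : A) : exists d, filt h E d a := filt_exhaustive a.
have basis : is_basis (@pbw K A (p - 2) n h E).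
  split; last exact: pbw_span n_gt0 EC Eh Etop E0n exh.
  move=> s c us sum0.
  pose f : free_alg K := \sum_(t <- s) c t *:
    pbw (gen K lh) (fun k => bracket K (omega k)) t.
  have pif : to_Tbarn' n p_prime f = 0.
    rewrite -[RHS]sum0 /f raddf_sum; apply: eq_bigr => t _ /=.
    by rewrite to_Tbarn'Z rmorph_pbw.
  have mp : (p - 2 < p.-1)%N by rewrite pE.
  have [q fq] := to_Tbarn'_annihilator n0 mp pif 1.
  apply: (pbw_poly_indep n_gt0 (q := q) us); rewrite -fq /f act_sum.
  by apply: eq_bigr => t _; rewrite actZ act_pbw.
split.
- by rewrite pE; apply: GKdim_pbw basis.
- exact: basis.
- split=> [|s _||s t _]; [exact: E0n | exact: Eh | | exact: EC].
  by rewrite Eh Etop addr0.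
Qed.
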